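(* For each integer $k>1$, \[ F_k(x;a,b)=\frac{(1 - b^{2k}x^k)^{k-1}f_{k-1}(x;a,b^k)} {p(\sqrt{x})\,p(-\sqrt{x})\,(1 - b^{2k}x^k)^{k-1}f_{k-1}(x;a,-b^k)-(k-1)a^kb^kx^kf_{k-1}(x;a,b^k)}, \] where $p(x)=1-ax-b^kx^k$, and $f_{k-1}(x;a,\pm b^k)$ denotes the polynomial $f_{k-1}(x;a,b)$ defined below with $b$ replaced by $\pm b^k$.
   Context: For positive integers $m,n,k$, an $m\times n$ rectangle has height $m$ and width $n$ (placed with bottom-left corner at the origin, so it is $[0,n]\times[0,m]$). Let $\mathcal{T}(m,n;k)$ be the set of tilings of the $m\times n$ rectangle by straight tiles of size $k\times 1$ (each tile covers $k$ consecutive unit cells in a single column, called a vertical tile, or $k$ consecutive unit cells in a single row, called a horizontal tile). For $T\in\mathcal{T}(m,n;k)$ set $w(T)=a^vb^h$, where $v,h$ are the numbers of vertical and horizontal tiles, and $t(m,n;k)=\sum_{T\in\mathcal{T}(m,n;k)}w(T)$ (with $t(m,0;k)=1$ for the empty tiling). Define $F_k(x;a,b)=\sum_{n\ge 0}t(2k,n;k)x^n$. For a positive integer $N$ define \[ f_N(x;a,b)=\sum_{s=0}^{N(N+1)/2} c_s(N)\,a^{\mathrm{rem}(2s,N+1)}\,b^{\lfloor 2s/(N+1)\rfloor}x^s, \] where $\mathrm{rem}(2s,N+1)$ is the remainder of $2s$ upon division by $N+1$, and, writing $q_j,r_j$ for the quotient and remainder of $s$ upon division by $N+j$ ($j\in\{0,1\}$),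 \[ c_s(N)=\begin{cases}1 & s=0,\\ (-1)^{q_1+1}\binom{N-r_1}{q_1}\binom{q_1+r_1-\lfloor N/2\rfloor-1}{q_1} & \lfloor 2s/(N+1)\rfloor\text{ odd and } r_1>\lfloor N/2\rfloor,\\ (-1)^{q_0}\binom{r_0-1}{q_0-1}\binom{\lfloor N/2\rfloor-r_0+q_0}{q_0} & \lfloor 2s/(N+1)\rfloor\text{ even and } r_0\le\lfloor N/2\rfloor,\\ 0 & \text{otherwise.}\end{cases} \] Binomial coefficients $\binom{n}{j}$ are $0$ when $j<0$ or when $n$ or $j$ is not an integer. *)

(* Defs.v *)
From HB Require Import structures.
From mathcomp Require Import all_boot all_order all_algebra.

Set Implicit Arguments.
Unset Strict Implicit.
Unset Printing Implicit Defensive.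

Import GRing.Theory Num.Theory.

Local Open Scope ring_scope.

(* The m x n rectangle has height m and width n; (i, j) is the unit cell in
   row i (counted from the bottom) and column j (counted from the left). *)
Notation cell m n := ('I_m * 'I_n)%type.

Definition vtile_at (m n k : nat) (c : cell m n) : {set cell m n} :=
  [set d : cell m n | (d.2 == c.2) && (c.1 <= d.1 < c.1 + k)%N].

Definition htile_at (m n k : nat) (c : cell m n) : {set cell m n} :=
  [set d : cell m n | (d.1 == c.1) && (c.2 <= d.2 < c.2 + k)%N].

(* The bounds c.1 + k <= m and c.2 + k <= n say that the tile lies inside the
   rectangle, i.e. that the sets above really consist of k cells. *)
Definition is_vtile (m n k : nat) (B : {set cell m n}) : bool :=
  [exists c : cell m n, (c.1 + k <= m)%N && (B == vtile_at k c)].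

Definition is_htile (m n k : nat) (B : {set cell m n}) : bool :=
  [exists c : cell m n, (c.2 + k <= n)%N && (B == htile_at k c)].

Definition is_tiling (m n k : nat) (T : {set {set cell m n}}) : bool :=
  partition T [set: cell m n] &&
  [forall B in T, is_vtile k B || is_htile k B].

Definition tilings (m n k : nat) : {set {set {set cell m n}}} :=
  [set T | is_tiling k T].

Definition nvert (m n k : nat) (T : {set {set cell m n}}) : nat :=
  #|[set B in T | is_vtile k B]|.

Definition nhoriz (m n k : nat) (T : {set {set cell m n}}) : nat :=
  #|[set B in T | is_htile k B]|.

Definition tiling_weight (R : comUnitRingType) (a b : R) (m n k : nat)
    (T : {set {set cell m n}}) : R :=
  a ^+ nvert k T * b ^+ nhoriz k T.

Definition tiling_sum (R : comUnitRingType) (a b : R) (m n k : nat) : R :=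
  \sum_(T in tilings m n k) tiling_weight a b k T.

(* F = P / Q in R[[x]], with F given by its coefficient sequence: Q is invertible in R[[x]] (that is, its constant term
   is a unit of R) and F * Q = P, where F * Q is the Cauchy product. *)
Definition fps_eq_quot (R : comUnitRingType) (F : nat -> R) (P Q : {poly R}) :
    Prop :=
  Q`_0 \is a GRing.unit /\
  forall n : nat, \sum_(i < n.+1) F i * Q`_(n - i) = P`_n.

Definition F_ser (R : comUnitRingType) (k : nat) (a b : R) : nat -> R :=
  fun n => tiling_sum a b (2 * k) n k.

(* Binomial coefficient with integer arguments: 0 if j < 0, and otherwise
   n (n - 1) ... (n - j + 1) / j!, which for n = - (m + 1) equals
   (-1)^j 'C(m + j, j). *)
Definition binz (n j : int) : int :=
  match j, n with
  | Negz _, _ => 0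
  | Posz j', Posz n' => 'C(n', j')%:Z
  | Posz j', Negz m => (-1) ^+ j' * 'C(m + j', j')%:Z
  end.

Definition c_coef (N s : nat) : int :=
  let q0 := (s %/ N)%N in let r0 := (s %% N)%N in
  let q1 := (s %/ N.+1)%N in let r1 := (s %% N.+1)%N in
  let h := (N %/ 2)%N in
  let e := (2 * s %/ N.+1)%N in
  if s == 0%N then 1
  else if odd e && (h < r1)%N then
    (-1) ^+ q1.+1 * binz (N%:Z - r1%:Z) q1%:Z
                  * binz (q1%:Z + r1%:Z - h%:Z - 1) q1%:Z
  else if ~~ odd e && (r0 <= h)%N then
    (-1) ^+ q0 * binz (r0%:Z - 1) (q0%:Z - 1)
               * binz (h%:Z - r0%:Z + q0%:Z) q0%:Z
  else 0.

Definition f_poly (R : comUnitRingType) (N : nat) (a b : R) : {poly R} :=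
  \sum_(s < (N * N.+1 %/ 2).+1)
    ((c_coef N s)%:~R * a ^+ (2 * s %% N.+1) * b ^+ (2 * s %/ N.+1)) *: 'X^s.

Definition p_poly (R : comUnitRingType) (k : nat) (a b : R) : {poly R} :=
  1 - a *: 'X - (b ^+ k) *: 'X^k.

(* For any polynomial p, p(y) p(-y) is a polynomial in y^2; p(sqrt x) p(-sqrt x)
   is that polynomial evaluated at x = y^2, see sqrt_prodE. *)
Definition sqrt_prod (R : comUnitRingType) (p : {poly R}) : {poly R} :=
  even_poly (p * (p \Po (- 'X))).

Lemma sqrt_prodE (R : comUnitRingType) (p : {poly R}) :
  sqrt_prod p \Po 'X^2 = p * (p \Po (- 'X)).
Proof.
pose e := even_poly p; pose o := odd_poly p.
have pE : p = (e \Po 'X^2) + (o \Po 'X^2) * 'X by rewrite poly_even_odd.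
have qE : p * (p \Po (- 'X)) = (e ^+ 2 - 'X * o ^+ 2) \Po 'X^2.
  rewrite {1 2}pE comp_polyD comp_polyM -!comp_polyA comp_polyX.
  rewrite comp_Xn_poly sqrrN comp_polyB !comp_polyM comp_polyX mulrN.
  by rewrite mulrC -subr_sqr exprMn -!expr2 [in RHS]mulrC.
rewrite /sqrt_prod qE; congr (_ \Po _).
apply/polyP => i; rewrite coef_even_poly coef_comp_poly_Xn //.
by rewrite -muln2 dvdn_mull // mulnK.
Qed.

(* Main.v *)
Require Import Defs.
From mathcomp Require Import all_boot all_order all_algebra.
From mathcomp Require Import zify ring.
Set Implicit Arguments.
Unset Strict Implicit.
Unset Printing Implicit Defensive.
Import GRing.Theory Num.Theory.
Local Open Scope ring_scope.

(** Write [B = b^k]. Peel tiles off the right end of the [2k x n] rectangle. As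
soon as a column contains exactly one vertical tile, on rows [i, ..., i+k-1],
these [k] rows and the remaining [k] rows evolve as two strips until both end in
the same column. For [0 < i < k] the outer rows are too short to hold a vertical
tile, and all such pieces for one [i] contribute
[a^k B x^k / (1 - B^2 x^k)^(k-1)] to [1 - 1/F]. For [i = 0] and [i = k] the two
strips are independent tilings of height [k]; tracking the difference [d] of
their lengths gives series with [Y_d = a Y_(d-1) + B x^(k-d) Y_(k-d)].
Eliminating the unknowns from the centre [d = k/2] outwards is a two-term linear
recurrence, whose solution [fdet] is expressed by Chebyshev-like polynomials
with coefficients [(-1)^q 'C(n-j, q) 'C(q+j, q)]; these are the [c_s(N)] once
[s] is written as [q (N+1) + r]. *)

(** * Sums over partitions into tiles *)

Section PartitionSum.
Variables (R : comUnitRingType) (T : finType).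
Variables (tile : pred {set T}) (w : {set T} -> R).

Definition tile_partition (U : {set T}) (P : {set {set T}}) :=
  partition P U && [forall B in P, tile B].

Definition psum (U : {set T}) : R :=
  \sum_(P | tile_partition U P) \prod_(B in P) w B.

Lemma psum0 : psum set0 = 1.
Proof.
rewrite /psum (big_pred1 set0) ?big_set0 // => P.
rewrite /tile_partition /= partition_set0; case: eqP => [->|] //=.
by apply/forall_inP => B; rewrite inE.
Qed.

Lemma tile_partitionD1 (U : {set T}) (P : {set {set T}}) (B : {set T}) : tile_partition U P -> B \in P -> tile_partition (U :\: B) (P :\ B).
Proof.
case/andP => hP /forall_inP ht hB; rewrite /tile_partition partitionD1 //=.
by apply/forall_inP => C; rewrite !inE => /andP[_] /ht.
Qed.

Lemma tile_partitionU1 (U : {set T}) (P : {set {set T}}) (B : {set T}) : tile B -> B != set0 -> B \subset U ->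
  tile_partition (U :\: B) P -> tile_partition U (B |: P).
Proof.
move=> tB nB sB /andP[hP /forall_inP ht]; apply/andP; split.
  by rewrite -(setID U B) (setIidPr sB) partitionU1 // disjoints_subset setCD subsetUr.
by apply/forall_inP => C; rewrite !inE => /orP[/eqP->|/ht].
Qed.

(** Partitions are sorted by their block [B] containing [c]; deleting [B] is a bijection onto the
    tile partitions of [U :\: B]. *)
Lemma psum_rec (c : T) (U : {set T}) : c \in U ->
  psum U = \sum_(B | [&& tile B, c \in B & B \subset U]) w B * psum (U :\: B).
Proof.
move=> cU; rewrite /psum.
rewrite (partition_big (fun P => pblock P c)
  (fun B => [&& tile B, c \in B & B \subset U])) /=; last first.
  move=> P /andP[hP /forall_inP ht].
  have cP : c \in cover P by rewrite (cover_partition hP).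
  rewrite ht ?pblock_mem //= mem_pblock cP /=.
  by rewrite (partitionS hP) ?pblock_mem.
apply: eq_bigr => B /and3P[tB cB sB].
have nB : B != set0 by apply/set0Pn; exists c.
have nin P : tile_partition (U :\: B) P -> B \notin P.
  move=> /andP[hP _]; apply/negP => BP.
  have : c \in cover P by apply/bigcupP; exists B.
  by rewrite (cover_partition hP) inE cB.
rewrite mulr_sumr.
rewrite (reindex_onto (fun P => B |: P) (fun P => P :\ B)) /=; last first.
  move=> P /andP[/andP[hP _] /eqP <-]; rewrite setD1K // pblock_mem //.
  by rewrite (cover_partition hP).
apply: eq_big => [P|P /andP[/andP[hP1 hP2] hP3]]; last first.
  rewrite big_setU1 //=; apply/negP => BP.
  by move/eqP/setP/(_ B): hP3; rewrite !inE eqxx BP.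
apply/andP/idP => [[/andP[hP _] /eqP hD]|hP].
  by rewrite -hD; apply: tile_partitionD1; rewrite // setU11.
have hPU := tile_partitionU1 tB nB sB hP.
rewrite hPU /= setU1K ?nin // eqxx; split=> //.
apply/eqP/def_pblock => //; last by rewrite setU11.
by case/andP: hPU => /and3P[].
Qed.
End PartitionSum.

(** * Tilings of staircase regions *)

Section Profile.
Variables (R : comUnitRingType) (a b : R) (m k : nat).
Hypothesis hk : (1 < k)%N.

Definition is_tile n (B : {set cell m n}) := is_vtile k B || is_htile k B.
Definition tile_weight n (B : {set cell m n}) : R :=
  if is_vtile k B then a else b.

(* Row [i] of the region consists of its first [p i] cells, so that a tiling of
   the rectangle is built from the right. *)
Definition region n (p : nat -> nat) : {set cell m n} :=
  [set c : cell m n | (c.2 < p c.1)%N].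
Definition region_sum n p : R := psum (@is_tile n) (@tile_weight n) (region n p).

Definition hcut (p : nat -> nat) i j := if j == i then (p j - k)%N else p j.
Definition vcut (p : nat -> nat) i j :=
  if (i <= j < i + k)%N then (p j - 1)%N else p j.

(** A vertical tile meets two rows because [1 < k], a horizontal one only one; so [tile_weight] is
    unambiguous. *)
Lemma htile_not_vtile n (B : {set cell m n}) : is_htile k B -> ~~ is_vtile k B.
Proof.
move=> /existsP[[i j] /andP[/= _ /eqP ->]]; apply/negP.
case/existsP => -[i' j'] /andP[/= hi /eqP /setP E].
have h1 : (i'.+1 < m)%N by lia.
have := E (i', j'); have := E (Ordinal h1, j'); rewrite !inE /= !eqxx /=.
have -> : (i' <= i'.+1 < i' + k)%N by lia.
have -> : (i' <= i' < i' + k)%N by lia.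
by move=> /andP[/eqP/(congr1 val)/= h _] /andP[/eqP/(congr1 val)/=]; lia.
Qed.

Lemma region_sum_ext n p p' : (forall i, (i < m)%N -> p i = p' i) ->
  region_sum n p = region_sum n p'.
Proof.
move=> E; rewrite /region_sum; congr psum.
by apply/setP => -[i j]; rewrite !inE /= E.
Qed.

Lemma region_sum0 n p : (forall i, (i < m)%N -> p i = 0%N) -> region_sum n p = 1.
Proof.
move=> E; rewrite /region_sum -[RHS](psum0 (@is_tile n) (@tile_weight n)).
by congr psum; apply/setP => -[i j]; rewrite !inE /= E.
Qed.

Lemma tiling_sum_region n :
  tiling_sum a b m n k = region_sum n (fun=> n).
Proof.
rewrite /tiling_sum /region_sum.
have -> : region n (fun=> n) = [set: cell m n].
  by apply/setP => -[i j]; rewrite !inE /= ltn_ord.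
apply: eq_big => [T|T]; first by rewrite inE.
rewrite inE => /andP[_ /forall_inP hT].
rewrite /tiling_weight /tile_weight (bigID (fun B => is_vtile k B)) /=.
congr (_ * _).
  rewrite /nvert (eq_bigr (fun=> a)) => [|B /andP[_ ->] //].
  by rewrite big_const iter_mulr_1 cardsE.
rewrite /nhoriz (eq_bigr (fun=> b)) => [|B /andP[_ /negPf->] //].
rewrite big_const iter_mulr_1; congr (_ ^+ _).
rewrite cardsE; apply: eq_card => B; rewrite !unfold_in /=.
apply: andb_id2l => BT; have := hT B BT.
case: (boolP (is_htile k B)) => [/htile_not_vtile->//|].
by rewrite orbF => _ ->.
Qed.

(** Consider the last cell of row [i], the lowest of the longest rows. A horizontal tile through it
    must end there. A vertical one must start in row [i], since the rows below are too short, and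
    all its rows must have maximal length. *)
Lemma region_sum_rec n p i : (i < m)%N -> (forall j, (j < m)%N -> (p j <= p i)%N) ->
  (forall j, (j < i)%N -> (p j < p i)%N) -> (0 < p i <= n)%N ->
  region_sum n p =
    (if (k <= p i)%N then b * region_sum n (hcut p i) else 0) +
    (if (i + k <= m)%N && all (fun j => p j == p i) (iota i k)
     then a * region_sum n (vcut p i) else 0).
Proof.
move=> im pmax pfirst /andP[p0 pn].
have hj : ((p i).-1 < n)%N by lia.
have hj' : ((p i - k) < n)%N by lia.
pose ri := Ordinal im; pose c : cell m n := (ri, Ordinal hj).
pose c' : cell m n := (ri, Ordinal hj').
rewrite /region_sum (@psum_rec _ _ _ _ c); last by rewrite inE /=; lia.
rewrite (bigID (fun B => is_vtile k B)) /= [in LHS]addrC.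
congr (_ + _).
  have E B : [&& is_tile B, c \in B & B \subset region n p] && ~~ is_vtile k B =
      (B == htile_at k c') && (k <= p i)%N.
    apply/idP/idP.
      case/andP => /and3P[/orP[->//|]].
      case/existsP => -[i1 j1] /andP[/= h1 /eqP->]; rewrite inE /= => /andP[/eqP <-] h2.
      move=> /subsetP hs _.
      have h3 : ((j1 + k).-1 < n)%N by lia.
      have := hs (ri, Ordinal h3); rewrite !inE /= eqxx /=.
      rewrite (_ : _ && _ = true); last by lia.
      move=> /(_ isT) h4.
      have -> : j1 = Ordinal hj' by apply: val_inj => /=; lia.
      by rewrite eqxx /=; lia.
    case/andP => /eqP -> hkp.
    have hB : is_htile k (htile_at k c').
      by apply/existsP; exists c'; rewrite eqxx andbT /=; lia.
    rewrite htile_not_vtile // andbT /is_tile hB orbT /=; apply/andP; split.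
      by rewrite inE /= eqxx /=; lia.
    by apply/subsetP => -[i1 j1]; rewrite !inE /= => /andP[/eqP-> /=]; lia.
  rewrite (eq_bigl _ _ E); case: ifP => hkp; last first.
    by rewrite big_pred0 // => B; rewrite andbF.
  rewrite (big_pred1 (htile_at k c')) => [|B]; last by rewrite andbT.
  have /negPf hB : ~~ is_vtile k (htile_at k c').
    by apply: htile_not_vtile; apply/existsP; exists c'; rewrite eqxx andbT /=; lia.
  rewrite /tile_weight hB; congr (_ * psum _ _ _).
  apply/setP => -[i1 j1]; rewrite !inE /= /hcut -val_eqE /=.
  by case: (eqVneq (val i1) i) => [e|] /=; rewrite ?e; lia.
have E B : [&& is_tile B, c \in B & B \subset region n p] && is_vtile k B =
    (B == vtile_at k c) && ((i + k <= m)%N && all (fun j => p j == p i) (iota i k)).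
  apply/idP/idP.
    case/andP => /and3P[_ cB /subsetP hs].
    case/existsP => -[i1 j1] /andP[/= h1 /eqP eB]; subst B.
    move: cB; rewrite inE /= => /andP[/eqP ej h2].
    have := hs (i1, j1); rewrite !inE /= eqxx leqnn -ej /=.
    have -> : (i1 < i1 + k)%N by lia.
    move=> /(_ isT) h3.
    (* The bottom cell of the tile lies in the region and in the last column of row [i]; [pfirst]
       excludes this when [i1 < i]. *)
    have ei : ri = i1.
      apply: val_inj => /=; have [//|h4] := leqP i i1; first by lia.
      by have := pfirst _ h4; lia.
    rewrite /c ej ei eqxx /=; move: (h1); rewrite -ei /= => -> /=.
    apply/allP => j; rewrite mem_iota => hj1.
    have h5 : (j < m)%N by move: h1; rewrite -ei /=; lia.
    have := hs (Ordinal h5, Ordinal hj); rewrite !inE /= -ei -ej eqxx /= hj1 => /(_ isT).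
    by have := pmax _ h5; lia.
  case/andP => /eqP -> /andP[him /allP ha].
  have hB : is_vtile k (vtile_at k c).
    by apply/existsP; exists c; rewrite eqxx andbT /=; lia.
  rewrite hB andbT /is_tile hB /=; apply/andP; split.
    by rewrite inE /= eqxx /=; lia.
  apply/subsetP => -[i1 j1]; rewrite !inE /= => /andP[/eqP->] h /=.
  have := ha i1; rewrite mem_iota => /(_ h)/eqP ->; lia.
rewrite (eq_bigl _ _ E); case: ifP => hkp; last first.
  by rewrite big_pred0 // => B; rewrite andbF.
rewrite (big_pred1 (vtile_at k c)) => [|B]; last by rewrite andbT.
case/andP: hkp => him /allP ha.
have hB : is_vtile k (vtile_at k c).
  by apply/existsP; exists c; rewrite eqxx andbT /=; lia.
rewrite /tile_weight hB; congr (_ * psum _ _ _).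
apply/setP => -[i1 j1]; rewrite !inE /= /vcut -val_eqE /=.
case: (boolP (i <= i1 < i + k)%N) => hi; last by rewrite andbF.
have := ha i1; rewrite mem_iota => /(_ hi)/eqP ->; lia.
Qed.
End Profile.

Lemma first_max (p : nat -> nat) m : (0 < m)%N ->
  exists i, [/\ (i < m)%N, forall j, (j < m)%N -> (p j <= p i)%N &
                forall j, (j < i)%N -> (p j < p i)%N].
Proof.
elim: m => // -[_ _|m IH _].
  by exists 0%N; split=> // -[].
case: IH => // i [im hi1 hi2]; case: (leqP (p m.+1) (p i)) => h.
  exists i; split=> // [|j]; first by lia.
  by rewrite ltnS leq_eqVlt => /orP[/eqP-> //|/hi1].
exists m.+1; split=> // j.
  by rewrite ltnS leq_eqVlt => /orP[/eqP-> //|/hi1]; lia.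
by move=> /hi1; lia.
Qed.

Lemma ltn_sum_ord (p q : nat -> nat) m i : (i < m)%N ->
  (forall j, (j < m)%N -> (q j <= p j)%N) -> (q i < p i)%N ->
  (\sum_(j < m) q j < \sum_(j < m) p j)%N.
Proof.
move=> im h hi; rewrite (bigD1 (Ordinal im)) //= [ltnRHS](bigD1 (Ordinal im)) //=.
by rewrite -addSn leq_add // leq_sum // => j _; apply: h.
Qed.

Section ProfileSum.
Variables (R : comUnitRingType) (a b : R) (m k : nat).
Hypothesis hk : (1 < k)%N.

(** The recurrence never mentions the ambient width, so induction on the number of cells applies. *)
Lemma region_sum_widen n n' p :
  (forall i, (i < m)%N -> (p i <= n)%N) ->
  (forall i, (i < m)%N -> (p i <= n')%N) ->
  region_sum a b m k n p = region_sum a b m k n' p.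
Proof.
have [s] := ubnP (\sum_(i < m) p i)%N; elim: s p => // s IH p hs hn hn'.
case: (posnP m) => [m0|m0]; first by rewrite !region_sum0 // => i; rewrite m0.
have [i [im hi1 hi2]] := first_max p m0.
case: (posnP (p i)) => [p0|p0].
  by rewrite !region_sum0 // => j /hi1; lia.
rewrite !(@region_sum_rec _ _ _ _ _ hk _ p i) //; try by rewrite p0 ?hn ?hn'.
congr (_ + _).
  case: ifP => // hkp; congr (_ * _).
  have hc j : (j < m)%N -> (hcut k p i j <= p j)%N by rewrite /hcut; case: ifP => *; lia.
  apply: IH => [|j jm|j jm]; try by apply: leq_trans (hc j jm) _; auto.
  rewrite -ltnS; apply: leq_trans hs; rewrite ltnS; apply: (ltn_sum_ord im hc).
  by rewrite /hcut eqxx; lia.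
case: ifP => // hkp; congr (_ * _).
have hc j : (j < m)%N -> (vcut k p i j <= p j)%N by rewrite /vcut; case: ifP => *; lia.
apply: IH => [|j jm|j jm]; try by apply: leq_trans (hc j jm) _; auto.
rewrite -ltnS; apply: leq_trans hs; rewrite ltnS; apply: (ltn_sum_ord im hc).
by rewrite /vcut; case: ifP => *; lia.
Qed.

(** Choosing the least admissible width makes the sum depend on the profile alone. *)
Definition profile_sum (p : nat -> nat) : R :=
  region_sum a b m k (\max_(i < m) p i)%N p.

Lemma profile_sumE n p : (forall i, (i < m)%N -> (p i <= n)%N) ->
  profile_sum p = region_sum a b m k n p.
Proof.
move=> hp; apply: region_sum_widen => // i im.
exact: (@leq_bigmax_cond _ xpredT (fun i : 'I_m => p i) (Ordinal im)).
Qed.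

Lemma profile_sum_ext p q : (forall i, (i < m)%N -> p i = q i) ->
  profile_sum p = profile_sum q.
Proof.
move=> E; rewrite /profile_sum (region_sum_ext _ _ _ _ E); congr region_sum.
by apply: eq_bigr => i _; apply: E.
Qed.

Lemma profile_sum_rec p i : (i < m)%N -> (forall j, (j < m)%N -> (p j <= p i)%N) ->
  (forall j, (j < i)%N -> (p j < p i)%N) -> (0 < p i)%N ->
  profile_sum p =
    (if (k <= p i)%N then b * profile_sum (hcut k p i) else 0) +
    (if (i + k <= m)%N && all (fun j => p j == p i) (iota i k)
     then a * profile_sum (vcut k p i) else 0).
Proof.
move=> im h1 h2 p0.
have hh j : (j < m)%N -> (hcut k p i j <= p i)%N by move=> /h1; rewrite /hcut; case: ifP => *; lia.
have hv j : (j < m)%N -> (vcut k p i j <= p i)%N by move=> /h1; rewrite /vcut; case: ifP => *; lia.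
rewrite (profile_sumE h1) (profile_sumE hh) (profile_sumE hv).
by apply: region_sum_rec => //; rewrite p0 /=.
Qed.

(* The rows in [A] are the longest ones; a vertical tile at their right end would
   need [k] consecutive rows in [A]. *)
Lemma profile_sum_forced (A : pred nat) q v :
  (forall i, (i < m)%N -> ~~ A i -> (q i < v)%N) ->
  (forall i, (i + k <= m)%N -> ~~ all A (iota i k)) -> (k <= v)%N ->
  profile_sum (fun i => if A i then v else q i) =
  b ^+ count A (iota 0 m) * profile_sum (fun i => if A i then (v - k)%N else q i).
Proof.
move=> + + kv.
have [s] := ubnP (count A (iota 0 m)); elim: s A q => // s IH A q hs hq hA.
case: (boolP (has A (iota 0 m))) => [/hasP[x xm Ax]|hN]; last first.
  have -> : count A (iota 0 m) = 0%N by apply/eqP; rewrite eqn0Ngt -has_count.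
  rewrite expr0 mul1r; apply: profile_sum_ext => i im.
  by case: ifP => // Ai; case/hasP: hN; exists i; rewrite ?mem_iota.
have ex : exists i, A i by exists x.
case: (ex_minnP ex) => i Ai imin.
have im : (i < m)%N by move: xm (imin _ Ax); rewrite mem_iota; lia.
rewrite (@profile_sum_rec _ i) ?Ai //; last 3 first.
- by move=> j jm; case: ifPn => // /(hq _ jm)/ltnW.
- move=> j ji; have /negPf Aj : ~~ A j by apply: contraL ji => /imin; rewrite -leqNgt.
  by rewrite Aj hq ?Aj // (ltn_trans ji im).
- by lia.
rewrite kv ifF ?addr0; last first.
  case: leqP => //= hm; apply: contraNF (hA _ hm) => /allP h.
  apply/allP => j jm; have := h _ jm; case: ifPn => // Aj; have := hq j.
  by rewrite Aj => + /eqP; move: jm; rewrite mem_iota => h1 /(_ ltac:(lia) isT); lia.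
(* Once cut, row [i] has length [v - k < v] and joins the short rows, so the induction runs on the
   size of [A]. *)
pose A' j := A j && (j != i).
pose q' j := if j == i then (v - k)%N else q j.
have cA : count A (iota 0 m) = (count A' (iota 0 m)).+1.
  have E s' : count A s' = (count A' s' + count_mem i s')%N.
    elim: s' => //= y s' ->; rewrite /A'.
    by case: eqP => [->|_]; rewrite ?Ai ?andbF ?andbT /=; lia.
  by rewrite E count_uniq_mem ?iota_uniq // mem_iota im addn1.
rewrite (@profile_sum_ext _ (fun j => if A' j then v else q' j)); last first.
  by move=> j _; rewrite /hcut /A' /q'; case: eqP => [->|]; rewrite ?Ai ?andbF ?andbT.
rewrite IH.
- rewrite cA exprS mulrA; congr (_ * _); apply: profile_sum_ext => j _.
  by rewrite /A' /q'; case: eqP => [->|]; rewrite ?Ai ?andbF ?andbT.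
- by lia.
- move=> j jm; rewrite /A' /q'; case: eqP => [|_]; first by lia.
  by rewrite andbT; apply: hq.
move=> j jm; apply: contra (hA _ jm) => /allP h; apply/allP => l /h.
by case/andP.
Qed.
End ProfileSum.

(** * Two strips of height k *)

Lemma count_interval x y n :
  count (fun j => x <= j < y)%N (iota 0 n) = (minn y n - x)%N.
Proof.
elim: n => [|n IH]; first by rewrite minn0.
by rewrite -addn1 iotaD count_cat IH /= add0n; case: (boolP (x <= n < y)%N) => h; lia.
Qed.

Section Strips.
Variables (R : comUnitRingType) (a b : R) (k : nat).
Hypothesis hk : (1 < k)%N.
Local Notation Z := (profile_sum a b (2 * k) k).

Definition strips i u v (j : nat) : nat := if (i <= j < i + k)%N then u else v.

Lemma profile_sum_forced_interval x y q v : (y < x + k)%N -> (y <= 2 * k)%N ->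
  (forall i, (i < 2 * k)%N -> ~~ (x <= i < y)%N -> (q i < v)%N) -> (k <= v)%N ->
  Z (fun i => if (x <= i < y)%N then v else q i) =
  b ^+ (y - x) * Z (fun i => if (x <= i < y)%N then (v - k)%N else q i).
Proof.
move=> yx yk hq kv.
rewrite (@profile_sum_forced _ _ _ _ _ hk (fun i => x <= i < y)%N) //.
  by rewrite count_interval (minn_idPl yk).
move=> i _; apply/negP => /allP h.
have := h i; have := h (i + k).-1; rewrite !mem_iota.
by move=> /(_ ltac:(lia)) + /(_ ltac:(lia)); lia.
Qed.

(** The longer strip ends either in a vertical tile filling its last column or in a horizontal one
    in row [i]. In the latter case only [k - 1] rows of length [u] remain, and these are forced to
    be horizontal. *)
Lemma strips_sum_mid i u v : (i <= k)%N -> (v < u)%N ->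
  Z (strips i u v) = a * Z (strips i u.-1 v) +
    (if (k <= u)%N then b ^+ k * Z (strips i (u - k) v) else 0).
Proof.
move=> ik vu.
have pi : strips i u v i = u by rewrite /strips ifT //; lia.
rewrite (@profile_sum_rec _ _ _ _ _ hk _ i) ?pi; first last.
- by lia.
- by move=> j ji; rewrite /strips ifF //; lia.
- by move=> j _; rewrite /strips; case: ifP => _ //; lia.
- by lia.
rewrite addrC; congr (_ + _).
  rewrite ifT; last first.
    apply/andP; split; first by lia.
    by apply/allP => j; rewrite mem_iota /strips => ->.
  congr (_ * _); apply: profile_sum_ext => j _; rewrite /vcut /strips.
  by case: ifP => [h|h]; rewrite ?subn1 ?h.
case: ifP => // ku.
rewrite (@profile_sum_ext _ _ _ _ _ _
  (fun j => if (i.+1 <= j < i + k)%N then u else hcut k (strips i u v) i j)).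
  rewrite profile_sum_forced_interval //; try lia.
    rewrite mulrA -exprS (_ : (i + k - i.+1).+1 = k); last by lia.
    congr (_ * _); apply: profile_sum_ext => j _; rewrite /hcut /strips.
    by case: (eqVneq j i) => [->|ji]; case: ifP => h; case: ifP => //; lia.
  move=> j _; rewrite /hcut /strips.
  by case: (eqVneq j i) => [->|ji]; case: ifP => h; lia.
move=> j _; rewrite /hcut /strips.
by case: (eqVneq j i) => [->|ji]; case: ifP => h; case: ifP => //; lia.
Qed.

(** The outer rows form blocks of heights [i] and [k - i], both below [k], so only horizontal tiles
    can end there; for [v < k] not even these fit. *)
Lemma strips_sum_out i u v : (0 < i < k)%N -> (u < v)%N ->
  Z (strips i u v) = if (k <= v)%N then b ^+ k * Z (strips i u (v - k)) else 0.
Proof.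
move=> ik uv; case: ifP => kv.
  pose q j := if (i <= j < i + k)%N then u else 0%N.
  rewrite (@profile_sum_ext _ _ _ _ _ _
    (fun j => if ~~ (i <= j < i + k)%N then v else q j)); last first.
    by move=> j _; rewrite /strips /q; case: ifP.
  rewrite (@profile_sum_forced _ _ _ _ _ hk (fun j => ~~ (i <= j < i + k)%N)) //.
  - have -> : count (fun j => ~~ (i <= j < i + k)%N) (iota 0 (2 * k)) = k.
      have := count_predC (fun j => i <= j < i + k)%N (iota 0 (2 * k)).
      rewrite count_interval size_iota; set c := count _ _.
      by rewrite -/c; lia.
    by congr (_ * _); apply: profile_sum_ext => j _; rewrite /strips /q; case: (i <= j < i + k)%N.
  - by move=> j _; rewrite negbK /q => ->.
  move=> j jk; apply/negP => /allP h.
  case: (leqP j i) => ji.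
    by have := h i; rewrite mem_iota => /(_ ltac:(lia)); lia.
  by have := h (i + k).-1; rewrite mem_iota => /(_ ltac:(lia)); lia.
have p0 : strips i u v 0 = v by rewrite /strips ifF //; lia.
rewrite (@profile_sum_rec _ _ _ _ _ hk _ 0) ?p0 ?kv; first last.
- by lia.
- by [].
- by move=> j _; rewrite /strips; case: ifP => _ //; lia.
- by lia.
rewrite add0r ifF //; apply/negP => /andP[_ /allP h].
have := h i; rewrite mem_iota /strips ifT; last by lia.
by move=> /(_ ltac:(lia)); lia.
Qed.

Lemma strips_sum_swap u v : Z (strips 0 u v) = Z (strips k v u).
Proof.
apply: profile_sum_ext => j jk; rewrite /strips.
by case: ifP => h; case: ifP => //; lia.
Qed.

(** Which strip lies on top is immaterial: [strips_sum_mid] has the same form for [i = 0] and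
    [i = k], and [strips_sum_swap] reduces [u < v] to [v < u]. *)
Lemma strips_sum_sym u v : Z (strips 0 u v) = Z (strips k u v).
Proof.
have [s] := ubnP (u + v)%N; elim: s u v => // s IH.
have H u v : (v < u)%N -> (u + v < s.+1)%N -> Z (strips 0 u v) = Z (strips k u v).
  move=> vu hs; rewrite [LHS]strips_sum_mid // [RHS]strips_sum_mid //; congr (_ * _ + _); first by apply: IH; lia.
  by case: ifP => // ku; congr (_ * _); apply: IH; lia.
move=> u v hs; case: (ltngtP u v) => uv.
- by rewrite strips_sum_swap -strips_sum_swap strips_sum_swap -H ?strips_sum_swap //; lia.
- exact: H.
by apply: profile_sum_ext => j _; rewrite uv /strips !if_same.
Qed.

(** The profile arises from a full rectangle after [i] horizontal tiles laid from the bottom; row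
    [i] takes another one or starts a vertical tile. *)
Lemma staircase_sum_rec i u : (i <= k)%N -> (k <= u)%N ->
  Z (fun j => if (j < i)%N then (u - k)%N else u) =
  b * Z (fun j => if (j < i.+1)%N then (u - k)%N else u) +
  a * Z (fun j => if (j < i)%N then (u - k)%N
                  else if (j < i + k)%N then u.-1 else u).
Proof.
move=> ik ku.
rewrite (@profile_sum_rec _ _ _ _ _ hk _ i) ?ltnn ?ku; first last.
- by lia.
- by move=> j ji; rewrite ji; lia.
- by move=> j _; case: ifP => _; lia.
- by lia.
congr (_ + _).
  congr (_ * _); apply: profile_sum_ext => j _; rewrite /hcut.
  by case: (eqVneq j i) => [->|ji]; rewrite ?ltnn ?ltnSn //; case: ifP => h; case: ifP => //; lia.
rewrite ifT; last first.
  apply/andP; split; first by lia.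
  by apply/allP => j; rewrite mem_iota => h; rewrite ifF //; lia.
congr (_ * _); apply: profile_sum_ext => j _; rewrite /vcut.
case: (ltnP j i) => h //=; case: (ltnP j (i + k)) => h1 //=.
by rewrite subn1.
Qed.

(** Above the vertical tile only [k - i < k] rows of length [u] are left, and these are forced to be
    horizontal. *)
Lemma staircase_sum_strips i u : (0 < i <= k)%N -> (k <= u)%N ->
  Z (fun j => if (j < i)%N then (u - k)%N
              else if (j < i + k)%N then u.-1 else u) =
  b ^+ (k - i) * Z (strips i u.-1 (u - k)).
Proof.
move=> ik ku.
rewrite (@profile_sum_ext _ _ _ _ _ _ (fun j => if (i + k <= j < 2 * k)%N then u
    else strips i u.-1 (u - k) j)).
  rewrite profile_sum_forced_interval; try lia.
    rewrite (_ : (2 * k - (i + k) = k - i)%N); last by lia.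
    congr (_ * _); apply: profile_sum_ext => j jk; rewrite /strips.
    by case: ifP => h1 //; case: ifP => h2 //; lia.
  by move=> j jk; rewrite /strips => h; case: ifP => h1; lia.
move=> j jk; rewrite /strips.
by case: ifP => h1; [|case: ifP => h2]; case: ifP => h3; try case: ifP => h4; lia.
Qed.

(** Here [l] is the bottom row of the vertical tile: [l - i] horizontal tiles below it and [k - l]
    above it give the exponent [k - i]. At [i = k.+1] too few rows remain for a vertical tile. *)
Lemma staircase_sum i u : (0 < i <= k.+1)%N -> (k <= u)%N ->
  Z (fun j => if (j < i)%N then (u - k)%N else u) =
  b ^+ (2 * k - i) * Z (fun=> u - k)%N +
  \sum_(i <= l < k.+1) a * b ^+ (k - i) * Z (strips l u.-1 (u - k)).
Proof.
move=> + ku; move en : (k.+1 - i)%N => n; elim: n i en => [|n IH] i en ik.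
  have -> : i = k.+1 by lia.
  rewrite big_geq // addr0.
  rewrite (@profile_sum_ext _ _ _ _ _ _ (fun j => if (k.+1 <= j < 2 * k)%N then u
    else (u - k)%N)); last first.
    by move=> j jk; case: ifP => h1; case: ifP => h2 //; lia.
  rewrite profile_sum_forced_interval; try lia.
  by congr (_ * _); apply: profile_sum_ext => j _; rewrite if_same.
rewrite staircase_sum_rec ?IH ?staircase_sum_strips; try lia.
rewrite [in RHS]big_ltn; last by lia.
rewrite mulrDr mulrA -exprS (_ : (2 * k - i.+1).+1 = (2 * k - i)%N); last by lia.
rewrite -addrA; congr (_ + _); rewrite addrC mulrA; congr (_ + _).
rewrite mulr_sumr; apply: eq_big_nat => l hl.
rewrite [in RHS](_ : (k - i = (k - i.+1).+1)%N); last by lia.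
by rewrite exprS; ring.
Qed.

(** The last column contains two vertical tiles, none, or exactly one, with bottom row [l]. *)
Lemma full_sum_rec u : (0 < u)%N ->
  Z (fun=> u) = a ^+ 2 * Z (fun=> u.-1) +
    (if (k <= u)%N then b ^+ (2 * k) * Z (fun=> u - k)%N
       + \sum_(l < k.+1) a * b ^+ k * Z (strips l u.-1 (u - k)) else 0).
Proof.
move=> u0.
have E : a * Z (strips 0 u.-1 u) = a ^+ 2 * Z (fun=> u.-1) +
    (if (k <= u)%N then a * b ^+ k * Z (strips 0 u.-1 (u - k)) else 0).
  rewrite strips_sum_swap strips_sum_mid //; last by lia.
  rewrite mulrDr mulrA -expr2; congr (_ * _ + _).
    by apply: profile_sum_ext => j _; rewrite /strips if_same.
  by case: ifP => _; rewrite ?mulr0 // -mulrA -strips_sum_swap.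
case: (leqP k u) => ku; last first.
  rewrite (@profile_sum_rec _ _ _ _ _ hk _ 0) //; last by lia.
  rewrite leqNgt ku /= add0r ifT; last first.
    by apply/andP; split; [lia|apply/allP].
  move: E; rewrite [(k <= u)%N]leqNgt ku /= => <-; congr (_ * _).
  by apply: profile_sum_ext => j _; rewrite /vcut /strips subn1.
rewrite ku in E.
have -> : Z (fun=> u) = b * Z (fun j => if (j < 1)%N then (u - k)%N else u) +
    a * Z (strips 0 u.-1 u) by exact: (staircase_sum_rec (leq0n k) ku).
rewrite staircase_sum // big_add1 big_mkord /= big_ord_recl.
have -> : \sum_(l < k) a * b ^+ k * Z (strips (lift ord0 l) u.-1 (u - k)) =
    b * \sum_(l < k) a * b ^+ (k - 1) * Z (strips l.+1 u.-1 (u - k)).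
  rewrite [RHS]mulr_sumr; apply: eq_bigr => l _.
  by rewrite -{1}(subnK (ltnW hk)) addn1 exprS !mulrA (mulrC a).
rewrite E mulrDr mulrA -exprS (_ : (2 * k - 1).+1 = (2 * k)%N); last by lia.
by rewrite [LHS]addrC -addrA; congr (_ + _); rewrite addrCA.
Qed.
End Strips.

(** * Elimination from the centre *)

Section Vanish.
Variables (R : comUnitRingType) (M : nat).

(* Series are handled as polynomials modulo ['X^M]. *)
Definition vanish (P : {poly R}) := forall i, (i < M)%N -> P`_i = 0.

Lemma vanishD P Q : vanish P -> vanish Q -> vanish (P + Q).
Proof. by move=> hP hQ i iM; rewrite coefD hP ?hQ ?addr0. Qed.

Lemma vanishM C P : vanish P -> vanish (C * P).
Proof.
move=> hP i iM; rewrite coefM big1 // => j _; rewrite hP ?mulr0 //.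
by apply: leq_ltn_trans iM; exact: leq_subr.
Qed.

Lemma vanish0 : vanish 0.
Proof. by move=> i _; rewrite coef0. Qed.

Lemma vanish_sum I (r : seq I) (P : pred I) (F : I -> {poly R}) :
  (forall i, P i -> vanish (F i)) -> vanish (\sum_(i <- r | P i) F i).
Proof. by move=> h; apply: big_ind => //; [apply: vanish0|apply: vanishD]. Qed.

End Vanish.

Section Cheb.
Variables (R : comUnitRingType) (A E : {poly R}).

(* [cheb n] is the coefficient of [z^n] in [1 / ((1 - z) (1 - A z) + E z)];
   [chebP n] is [cheb (n - 1)], with [cheb (-1) = 0]. *)
Fixpoint cheb2 n : {poly R} * {poly R} :=
  if n is n'.+1 then
    let: (u, v) := cheb2 n' in ((1 + A - E) * u - A * v, u)
  else (1, 0).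

Definition cheb n := (cheb2 n).1.
Definition chebP n := (cheb2 n).2.

Lemma cheb0 : cheb 0 = 1. Proof. by []. Qed.
Lemma chebP0 : chebP 0 = 0. Proof. by []. Qed.
Lemma chebS n : cheb n.+1 = (1 + A - E) * cheb n - A * chebP n.
Proof. by rewrite /cheb /chebP /=; case: (cheb2 n). Qed.
Lemma chebPS n : chebP n.+1 = cheb n.
Proof. by rewrite /cheb /chebP /=; case: (cheb2 n). Qed.
End Cheb.

(* The determinant of the system [Y_d = a Y_(d-1) + B x^(k-d) Y_(k-d)], where
   [0 < d < k] and [k = N + 1]. *)
Definition fdet (R : comUnitRingType) (N : nat) (a B : R) : {poly R} :=
  let A := a%:P ^+ 2 * 'X in let E := B%:P ^+ 2 * 'X^(N.+1) in let h := (N %/ 2)%N in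
  cheb A E h - A * chebP A E h
  - a%:P ^+ odd N.+1 * B%:P * 'X^(h.+1) * cheb A E (N - h.+1).

Section Elim.
Variables (R : comUnitRingType) (a B : R) (M : nat) (Y : nat -> {poly R}).
Local Notation al := (a%:P).
Local Notation be := (B%:P).
Local Notation van := (vanish M).

(* [d] and [k - d] are eliminated together; [n] counts the pairs removed. The
   factor ['X^n] keeps both coefficients free of divisions. *)
Lemma elim_even m n :
  let k := (2 * m)%N in let A := al ^+ 2 * 'X in let E := be ^+ 2 * 'X^k in
  let bm := be * 'X^m in
  (forall d, (0 < d < k)%N ->
     van (Y d - (al * Y d.-1 + be * 'X^(k - d) * Y (k - d)%N))) ->
  (n < m)%N ->
  van (((1 - bm) * cheb A E n - A * chebP A E n) * 'X^n * Y (m + n)%N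
     - al * (cheb A E n - (1 - bm) * chebP A E n) * Y (m - n.+1)%N).
Proof.
move=> k A E bm hY; elim: n => [|n IH] nm.
  rewrite cheb0 chebP0 addn0 subn1 expr0.
  have := hY m ltac:(lia); rewrite (_ : (k - m)%N = m); last by rewrite /k; lia.
  by congr vanish; rewrite /bm; ring.
have {}IH := IH ltac:(lia).
have := hY (m + n).+1 ltac:(lia); have := hY (m - n.+1)%N ltac:(lia).
rewrite (_ : (k - (m + n).+1 = m - n.+1)%N); last by rewrite /k; lia.
rewrite (_ : (k - (m - n.+1) = (m + n).+1)%N); last by rewrite /k; lia.
rewrite (_ : (m - n.+1).-1 = (m - n.+2)%N); last by lia.
rewrite addnS /= => h2 h1; rewrite chebS chebPS.
(* The multipliers cancel [Y (m + n)] and [Y (m - n.+1)], leaving the next pair outwards. *)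
have := vanishD (vanishM ('X^(n.+1) * ((1 - bm) * cheb A E n - A * chebP A E n)) h1)
  (vanishD (vanishM (al * 'X) IH)
    (vanishM (A * (cheb A E n - (1 - bm) * chebP A E n)
      + bm * ((1 - bm) * cheb A E n - A * chebP A E n)) h2)).
congr vanish.
move: (cheb A E n) (chebP A E n) (Y _) (Y _) (Y _) (Y _) => U V y1 y2 y3 y4.
have e1 : 'X^m = 'X^(m - n.+1) * 'X^n * 'X :> {poly R}.
  by rewrite -exprD -exprSr; congr ('X^_); lia.
have e2 : 'X^k = 'X^m * 'X^m :> {poly R} by rewrite -exprD; congr ('X^_); rewrite /k; lia.
have e3 : 'X^((m + n).+1) = 'X^m * 'X^n * 'X :> {poly R} by rewrite -exprD -exprSr.
rewrite /A /E /bm e3 e2 e1 exprSr.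
move: ('X^(m - n.+1)) ('X^n) => x w; ring.
Qed.

(** For odd [k] no equation is its own partner, so the elimination starts from the trivial relation
    [Y m = Y m]; each step again cancels the inner pair. *)
Lemma elim_odd m n :
  let k := (2 * m).+1 in let A := al ^+ 2 * 'X in let E := be ^+ 2 * 'X^k in
  let C := al * be * 'X^(m.+1) in
  (forall d, (0 < d < k)%N ->
     van (Y d - (al * Y d.-1 + be * 'X^(k - d) * Y (k - d)%N))) ->
  (n <= m)%N ->
  van ((cheb A E n - (A + C) * chebP A E n) * 'X^n * Y (m + n)%N
     - (cheb A E n - (1 - E - C) * chebP A E n) * Y (m - n)%N).
Proof.
move=> k A E C hY; elim: n => [|n IH] nm.
  rewrite cheb0 chebP0 addn0 subn0 expr0 (_ : _ - _ = 0); last by ring.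
  exact: vanish0.
have {}IH := IH ltac:(lia).
have := hY (m + n).+1 ltac:(lia); have := hY (m - n)%N ltac:(lia).
rewrite (_ : (k - (m + n).+1 = m - n)%N); last by rewrite /k; lia.
rewrite (_ : (k - (m - n) = (m + n).+1)%N); last by rewrite /k; lia.
rewrite (_ : (m - n).-1 = (m - n.+1)%N); last by lia.
rewrite addnS /= => h2 h1; rewrite chebS chebPS.
have := vanishD (vanishM ('X^(n.+1) * (cheb A E n - (A + C) * chebP A E n)) h1)
  (vanishD (vanishM (al * 'X) IH)
    (vanishM (al * 'X * (cheb A E n - (1 - E - C) * chebP A E n)
      + be * 'X^(m.+1) * (cheb A E n - (A + C) * chebP A E n)) h2)).
congr vanish.
move: (cheb A E n) (chebP A E n) (Y _) (Y _) (Y _) (Y _) => U V y1 y2 y3 y4.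
have e1 : 'X^m = 'X^(m - n) * 'X^n :> {poly R} by rewrite -exprD subnK //; lia.
have e2 : 'X^k = 'X^m * 'X^m * 'X :> {poly R}.
  by rewrite -exprD -exprSr; congr ('X^_); rewrite /k; lia.
have e3 : 'X^((m + n).+1) = 'X^m * 'X^n * 'X :> {poly R} by rewrite -exprD -exprSr.
rewrite /A /E /C e3 e2 !exprSr e1.
move: ('X^(m - n)) ('X^n) => x w; ring.
Qed.

End Elim.

(** * The product [p(sqrt x) p(-sqrt x)] by the parity of [k] *)

Lemma sqrt_prod_eq (R : comUnitRingType) (p q : {poly R}) :
  p * (p \Po (- 'X)) = q \Po 'X^2 -> sqrt_prod p = q.
Proof.
move=> E; rewrite /sqrt_prod E; apply/polyP => i.
rewrite coef_even_poly coef_comp_poly_Xn // -muln2 dvdn_mull // mulnK //.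
Qed.

(** For an odd exponent [k], [p(y) p(-y) = 1 - (a y + c y^k)^2]. *)
Lemma sqrt_prod_odd (R : comUnitRingType) (a c : R) h :
  sqrt_prod (1 - a *: 'X - c *: 'X^((2 * h).+1)) =
  1 - a%:P ^+ 2 * 'X - c%:P ^+ 2 * 'X^((2 * h).+1) - 2 * (a%:P * c%:P * 'X^(h.+1)).
Proof.
apply: sqrt_prod_eq; rewrite -!mul_polyC -!rmorphXn /=.
rewrite !(comp_polyB, comp_polyM, comp_polyC, comp_polyX, comp_Xn_poly, comp_polyD).
have e1 (z : {poly R}) : z ^+ (2 * h).+1 = z * (z ^+ h) ^+ 2.
  by rewrite exprS mulnC exprM.
have e2 (z : {poly R}) : z ^+ h.+1 = z * z ^+ h by rewrite exprS.
have e3 : ('X^2) ^+ h = ('X^h) ^+ 2 :> {poly R} by rewrite -!exprM mulnC.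
rewrite !polyC1 !rmorphXn /= !e1 e2 e3 exprNn (exprMn _ ((-1) ^+ h)) sqrr_sign.
move: ('X^h) => x; ring.
Qed.

Lemma sqrt_prod_even (R : comUnitRingType) (a c : R) h :
  sqrt_prod (1 - a *: 'X - c *: 'X^(2 * h)) = (1 - c%:P * 'X^h) ^+ 2 - a%:P ^+ 2 * 'X.
Proof.
apply: sqrt_prod_eq; rewrite expr2 -!mul_polyC -!rmorphXn /=.
rewrite !(comp_polyB, comp_polyM, comp_polyC, comp_polyX, comp_Xn_poly, comp_polyD).
have e (z : {poly R}) : z ^+ (2 * h) = (z ^+ h) ^+ 2 by rewrite mulnC exprM.
have e3 : ('X^2) ^+ h = ('X^h) ^+ 2 :> {poly R} by rewrite -!exprM mulnC.
rewrite ?polyC1 ?rmorphXn /= e3 !e exprNn (exprMn _ ((-1) ^+ h)) sqrr_sign.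
move: ('X^h) => x; ring.
Qed.

(** * Generating functions of the strips *)

Section Series.
Variables (R : comUnitRingType) (a b : R) (k M : nat).
Hypothesis hk : (1 < k)%N.
Local Notation Z := (profile_sum a b (2 * k) k).
Local Notation van := (vanish M).
Local Notation al := (a%:P).
Local Notation be := ((b ^+ k)%:P).

(** For [i = 0] this is [Y_d], truncated; the exponent records the shorter of the two lengths. *)
Definition strip_poly i d : {poly R} :=
  \poly_(s < M) Z (strips k i (s + d)%N s).
Definition F_poly : {poly R} := \poly_(s < M) Z (fun=> s).

Lemma strip_poly0 i : strip_poly i 0 = F_poly.
Proof.
apply/polyP => s; rewrite !coef_poly; case: ifP => // _.
by apply: profile_sum_ext => j _; rewrite /strips addn0 if_same.
Qed.

Lemma strip_poly_sym d : strip_poly k d = strip_poly 0 d.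
Proof.
by apply/polyP => s; rewrite !coef_poly; case: ifP => // _; rewrite strips_sum_sym.
Qed.

(** Cutting [k > d] off the longer strip makes it the shorter one, by [k - d]. The shorter length
    has then dropped by [k - d], and the symmetry of the strips identifies the result. *)
Lemma strip_poly_rec d : (0 < d < k)%N ->
  van (strip_poly 0 d -
    (al * strip_poly 0 d.-1 + be * 'X^(k - d) * strip_poly 0 (k - d))).
Proof.
move=> hd s sM; rewrite -mulrA !(coefB, coefN, coefD, coefCM, coefXnM, coef_poly) sM.
rewrite strips_sum_mid //; last by lia.
rewrite (_ : (s + d).-1 = (s + d.-1)%N); last by lia.
rewrite (_ : (s < k - d)%N = ~~ (k <= s + d)%N); last by lia.
case: (leqP k (s + d)) => h /=; last by rewrite mulr0 subrr.
rewrite ifT; last by lia.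
rewrite (_ : (s - (k - d) + (k - d) = s)%N); last by lia.
rewrite (_ : (s - (k - d) = s + d - k)%N); last by lia.
rewrite (strips_sum_sym _ _ hk (s + d - k)) -(strips_sum_swap _ _ hk s).
exact: subrr.
Qed.

(** When the inner strip loses [k], the outer rows become the longer ones and must lose [k] too;
    this restores the difference [d] at the cost of [be ^+ 2 * 'X^k]. *)
Lemma strip_poly_mid_rec i d : (0 < i < k)%N -> (0 < d < k)%N ->
  van ((1 - be ^+ 2 * 'X^k) * strip_poly i d - al * strip_poly i d.-1).
Proof.
move=> hi hd s sM.
rewrite mulrBl mul1r -rmorphXn /= -mulrA !(coefB, coefN, coefCM, coefXnM, coef_poly) sM.
rewrite (strips_sum_mid _ _ hk); try lia.
rewrite (_ : (s + d).-1 = (s + d.-1)%N); last by lia.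
case: (leqP k (s + d)) => h /=; last first.
  by rewrite ifT ?mulr0 ?subr0 ?addr0 ?subrr //; lia.
rewrite (strips_sum_out _ _ hk (u := s + d - k)) //; last by lia.
case: (leqP k s) => h1; rewrite ?mulr0 ?subr0 ?addr0 ?subrr //.
rewrite ifT; last by lia.
rewrite (_ : (s - k + d = s + d - k)%N); last by lia.
by rewrite mulrA -expr2 addrK; exact: subrr.
Qed.

Lemma strip_poly_mid i d : (0 < i < k)%N -> (d < k)%N ->
  van ((1 - be ^+ 2 * 'X^k) ^+ d * strip_poly i d - al ^+ d * F_poly).
Proof.
move=> hi; elim: d => [|d IH] hd.
  by rewrite strip_poly0 !expr0 subrr; apply: vanish0.
have h1 := vanishM ((1 - be ^+ 2 * 'X^k) ^+ d) (@strip_poly_mid_rec i d.+1 hi hd).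
have h2 := vanishM al (IH (ltnW hd)).
by have := vanishD h1 h2; congr vanish; rewrite !exprS /=; ring.
Qed.

Lemma F_poly_rec :
  van (F_poly - (1 + al ^+ 2 * 'X * F_poly + be ^+ 2 * 'X^k * F_poly
    + al * be * 'X^k * \sum_(l < k.+1) strip_poly l k.-1)).
Proof.
move=> s sM; rewrite -rmorphXn -[be ^+ 2]rmorphXn -[al * be]rmorphM /= -!mulrA.
rewrite !(coefB, coefN, coefD, coefCM, coefXM, coefXnM, coef1, coef_poly, coef_sum) sM.
case: s sM => [|s] sM /=.
  rewrite /profile_sum region_sum0 //.
  by rewrite (ltnW hk) !mulr0 !addr0; exact: subrr.
rewrite (full_sum_rec _ _ hk) //= add0r (ltnW sM).
case: (leqP k s.+1) => h /=; last by rewrite !mulr0 !addr0 subrr.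
rewrite ifT; last by lia.
apply/eqP; rewrite subr_eq0 -addrA -exprM (mulnC k 2); apply/eqP.
do 2!congr (_ + _).
rewrite [RHS]mulr_sumr; apply: eq_bigr => l _; rewrite coef_poly ifT; last by lia.
by congr (_ * Z (strips _ _ _ _)); lia.
Qed.
End Series.

(** Eliminating all unknowns but [Y_(k-1)] and [Y_0 = F] gives each of the positions [i = 0] and
    [i = k] the contribution [K F / fdet]. The second identity absorbs both, hence the factor 2,
    into [p(sqrt x) p(-sqrt x)]. *)
Lemma fdet_elim (R : comUnitRingType) (a b : R) (k M : nat) : (1 < k)%N ->
  let al := a%:P in let be := (b ^+ k)%:P in let A := al ^+ 2 * 'X in
  exists K : {poly R},
  vanish M (fdet (k - 1) a (b ^+ k) * (al * be * 'X^k * strip_poly a b k M 0 k.-1)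
            - K * F_poly a b k M) /\
  sqrt_prod (p_poly k a b) * fdet (k - 1) a (- b ^+ k) =
  (1 - A - be ^+ 2 * 'X^k) * fdet (k - 1) a (b ^+ k) - 2 * K.
Proof.
move=> hk al be A.
have hY := fun d => @strip_poly_rec R a b k M hk d.
(* [cheb] and [chebP] depend on [B] only through its square, so both determinants share their
   values. *)
rewrite -(strip_poly0 a b k M 0) /fdet polyCN sqrrN -/al -/be -/A /p_poly.
have -> : (k - 1).+1 = k by lia.
have [m [ek|ek]] : exists m, k = (2 * m)%N \/ k = (2 * m).+1.
  by exists k./2; have := odd_double_half k; case: odd => /= h; [right|left]; lia.
- have -> : ((k - 1) %/ 2 = m.-1)%N by lia.
  have -> : (k - 1 - m.-1.+1 = m.-1)%N by lia.
  have -> : m.-1.+1 = m by lia.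
  have -> : odd k = false by lia.
  rewrite (_ : 1 - _ - _ = 1 - a *: 'X - b ^+ k *: 'X^(2 * m)); last by rewrite -ek.
  rewrite sqrt_prod_even -/al -/be -/A.
  have := @elim_even R a (b ^+ k) M (strip_poly a b k M 0) m m.-1.
  rewrite /= -ek -/al -/be -/A => /(_ hY ltac:(lia)).
  set U := cheb _ _ _; set V := chebP _ _ _.
  have -> : (m + m.-1 = k.-1)%N by lia.
  have -> : (m - m.-1.+1 = 0)%N by lia.
  (* Up to sign, [K] is the coefficient of [Y_0] in [H] times [al * be * 'X^(m.+1)], the factor that
     completes ['X^(m.-1)] to ['X^k]. *)
  move=> H; exists (A * (be * 'X^m) * (U - (1 - be * 'X^m) * V)); split.
    have := vanishM (al * be * 'X^(m.+1)) H.
    have -> : 'X^k = 'X^(m.+1) * 'X^(m.-1) :> {poly R} by rewrite -exprD; congr ('X^_); lia.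
    by congr vanish; rewrite expr0 /A (exprS 'X m); move: ('X^m) ('X^(m.-1)) => x y; ring.
  rewrite expr0 {1}ek mulnC exprM /A; move: ('X^m) => x; ring.
have -> : ((k - 1) %/ 2 = m)%N by lia.
have -> : (k - 1 - m.+1 = m.-1)%N by lia.
have -> : odd k = true by lia.
have ec E : cheb A E m.-1 = chebP A E m.
  by rewrite -[in RHS](@prednK m) ?chebPS //; lia.
rewrite (_ : 1 - _ - _ = 1 - a *: 'X - b ^+ k *: 'X^((2 * m).+1)); last by rewrite -ek.
rewrite sqrt_prod_odd -ek -/al -/be -/A !ec.
have := @elim_odd R a (b ^+ k) M (strip_poly a b k M 0) m m.
rewrite /= -ek -/al -/be -/A => /(_ hY ltac:(lia)).
set U := cheb _ _ _; set V := chebP _ _ _.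
have -> : (m + m = k.-1)%N by lia.
rewrite subnn.
move=> H; exists (al * be * 'X^(m.+1) * (U - (1 - be ^+ 2 * 'X^k - al * be * 'X^(m.+1)) * V)); split.
  have := vanishM (al * be * 'X^(m.+1)) H.
  have -> : 'X^k = 'X^(m.+1) * 'X^m :> {poly R} by rewrite -exprD; congr ('X^_); lia.
  by congr vanish; rewrite expr1 /A; move: ('X^(m.+1)) ('X^m) => x y; ring.
rewrite expr1 /A; move: ('X^k) ('X^(m.+1)) => x y; ring.
Qed.

(** Denominators are cleared in [F_poly_rec]: the [k - 1] inner positions are replaced through
    [strip_poly_mid], the positions [0] and [k] through [fdet_elim]. *)
Lemma F_ser_fdet (R : comUnitRingType) (a b : R) (k M : nat) : (1 < k)%N ->
  let E := (1 - b ^+ (2 * k) *: 'X^k) ^+ (k - 1) in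
  vanish M (F_poly a b k M *
    (sqrt_prod (p_poly k a b) * E * fdet (k - 1) a (- b ^+ k)
     - ((k - 1)%:R * a ^+ k * b ^+ k) *: 'X^k * fdet (k - 1) a (b ^+ k))
    - E * fdet (k - 1) a (b ^+ k)).
Proof.
move=> hk E.
have [K [hK eK]] := fdet_elim a b M hk.
set D := fdet _ _ _ in hK eK *; set Dm := fdet _ _ _ in eK *.
set pp := sqrt_prod _ in eK *; set F := F_poly _ _ _ _ in hK *.
pose al := a%:P; pose be := (b ^+ k)%:P.
have EE : E = (1 - be ^+ 2 * 'X^k) ^+ k.-1.
  by rewrite /E subn1 -mul_polyC /be -rmorphXn /= -exprM mulnC.
have h3 : vanish M (\sum_(1 <= l < k) (E * strip_poly a b k M l k.-1 - al ^+ k.-1 * F)).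
  rewrite big_nat_cond; apply: vanish_sum => l /andP[hl _].
  by rewrite EE; apply: strip_poly_mid => //; lia.
rewrite sumrB -mulr_sumr sumr_const_nat in h3.
have h1 := @F_poly_rec R a b k M hk.
rewrite -(big_mkord xpredT (fun l => strip_poly a b k M l k.-1)) in h1.
rewrite big_nat_recr // big_ltn in h1; last by lia.
rewrite /= strip_poly_sym // in h1.
have := vanishD (vanishM (E * D) h1)
  (vanishD (vanishM (2 * E) hK) (vanishM (D * (al * be * 'X^k)) h3)).
congr vanish.
have -> : ((k - 1)%:R * a ^+ k * b ^+ k) *: 'X^k = (k - 1)%:R * (al * al ^+ k.-1) * be * 'X^k :> {poly R}.
  rewrite -exprS (prednK (ltnW hk)) -mul_polyC !rmorphM /= rmorphXn /= rmorph_nat //.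
rewrite -[al ^+ _ * F *+ _]mulr_natl -/F -/al -/be.
rewrite (_ : pp * E * Dm = E * (pp * Dm)); last by ring.
rewrite eK -/al -/be.
move: (strip_poly _ _ _ _ _ _) (\sum_(_ <= _ < _) _) ((k - 1)%:R) (al ^+ _) ('X^k) => y w kk an x.
ring.
Qed.

(** * The coefficients of f_N *)

Section DoubleSum.
Variables (S : comNzRingType) (A E : S) (K : nat).

(** With one bound [K] for all arrays, multiplying by [A] or [E] is an index shift as long as the
    last row or column is zero. *)
Definition dsum (u : nat -> nat -> int) : S :=
  \sum_(j < K.+1) \sum_(q < K.+1) (u j q)%:~R * A ^+ j * E ^+ q.

Definition shiftA (u : nat -> nat -> int) j q := if j is j'.+1 then u j' q else 0.
Definition shiftE (u : nat -> nat -> int) j q := if q is q'.+1 then u j q' else 0.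

Lemma eq_dsum u v : (forall j q, u j q = v j q) -> dsum u = dsum v.
Proof. by move=> h; apply: eq_bigr => j _; apply: eq_bigr => q _; rewrite h. Qed.

Lemma dsumD u v : dsum (fun j q => u j q + v j q) = dsum u + dsum v.
Proof.
rewrite /dsum -big_split; apply: eq_bigr => j _; rewrite -big_split.
by apply: eq_bigr => q _; rewrite /= rmorphD /= !mulrDl.
Qed.

Lemma dsumN u : dsum (fun j q => - u j q) = - dsum u.
Proof.
rewrite /dsum -sumrN; apply: eq_bigr => j _; rewrite -sumrN.
by apply: eq_bigr => q _; rewrite rmorphN /= !mulNr.
Qed.

Lemma dsum0 : dsum (fun _ _ => 0) = 0.
Proof. by rewrite /dsum big1 // => j _; rewrite big1 // => q _; rewrite !mul0r. Qed.

Lemma dsumA u : (forall q, u K q = 0) -> A * dsum u = dsum (shiftA u).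
Proof.
move=> h; rewrite /dsum big_ord_recr /= [X in _ + X]big1 ?addr0; last first.
  by move=> q _; rewrite h !mul0r.
rewrite [RHS]big_ord_recl /= [X in X + _]big1 ?add0r; last by move=> q _; rewrite !mul0r.
rewrite mulr_sumr; apply: eq_bigr => j _; rewrite mulr_sumr; apply: eq_bigr => q _.
by rewrite exprS; ring.
Qed.

Lemma dsumE u : (forall j, u j K = 0) -> E * dsum u = dsum (shiftE u).
Proof.
move=> h; rewrite /dsum mulr_sumr; apply: eq_bigr => j _.
rewrite big_ord_recr /= h !mul0r addr0 [RHS]big_ord_recl /= !mul0r add0r mulr_sumr.
by apply: eq_bigr => q _; rewrite exprS; ring.
Qed.
End DoubleSum.

(** The coefficient of [z^n A^j E^q] in the sum over [q] of [(- E z)^q / ((1 - z) (1 - A z))^(q+1)],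
    the expansion of the generating function of [cheb] in powers of [E]. *)
Definition cheb_coef n j q : int :=
  if (j <= n)%N then (-1) ^+ q * 'C(n - j, q)%:Z * 'C(q + j, q)%:Z else 0.
Definition chebP_coef n : nat -> nat -> int :=
  if n is n'.+1 then cheb_coef n' else fun _ _ => 0.

(** This is [chebS] on coefficients; it follows from Pascal's rule in both binomials, with boundary
    values of [j] and [q] treated apart. *)
Lemma cheb_coefS n j q : cheb_coef n.+1 j q =
  cheb_coef n j q + shiftA (cheb_coef n) j q - shiftE (cheb_coef n) j q
  - shiftA (chebP_coef n) j q.
Proof.
rewrite /cheb_coef; case: j => [|j] /=.
  rewrite !subn0 !addn0 !binn; case: q => [|q] /=; first by rewrite !bin0.
  by rewrite addn0 subn0 binn binS exprS PoszD; ring.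
rewrite ltnS; case: (leqP j n) => jn; last first.
  have jn' : (j < n)%N = false by lia.
  rewrite jn' /=; case: q => [|q] /=; rewrite ?jn'; case: n jn {jn'} => //= n jn;
    by rewrite /cheb_coef (_ : (j <= n)%N = false) //; lia.
case: (ltngtP j n) jn => // [jn _|-> _]; last first.
  rewrite !subnn; case: q => [|q] /=; rewrite ?bin0 ?bin0n /=.
    by case: n => //= n; rewrite /cheb_coef ltnn.
  by case: n => [|n] /=; rewrite /cheb_coef ?ltnn; ring.
case: n jn => // n; rewrite ltnS => jn /=; rewrite /cheb_coef jn subSS.
rewrite [in LHS](_ : (n.+1 - j = (n - j).+1)%N); last by lia.
rewrite [in 'C(n.+1 - j, _)](_ : (n.+1 - j = (n - j).+1)%N); last by lia.
case: q => [|q] /=; first by rewrite !bin0; ring.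
by rewrite ltnS jn !subSS !addSn !addnS !binS exprS !PoszD; ring.
Qed.

Lemma cheb_dsum (R : comUnitRingType) (A E : {poly R}) K n : (n <= K)%N ->
  cheb A E n = dsum A E K (cheb_coef n) /\ chebP A E n = dsum A E K (chebP_coef n).
Proof.
have hA n' : (n' < K)%N -> forall q, cheb_coef n' K q = 0.
  by move=> h q; rewrite /cheb_coef leqNgt h.
have hE n' : (n' < K)%N -> forall j, cheb_coef n' j K = 0.
  by move=> h j; rewrite /cheb_coef bin_small ?mulr0 ?mul0r ?if_same //; lia.
elim: n => [|n IH] hn.
  split; last by rewrite chebP0 dsum0.
  rewrite cheb0 /dsum big_ord_recl [X in _ + X]big1 ?addr0; last first.
    by move=> j _; rewrite big1 // => q _; rewrite /cheb_coef /= !mul0r.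
  rewrite big_ord_recl [X in _ + X]big1 ?addr0; last first.
    by move=> j _; rewrite /cheb_coef /= bin0n /= !mulr0 !mul0r.
  by rewrite /cheb_coef /= !mulr1.
have [IH1 IH2] := IH (ltnW hn).
split; last by rewrite chebPS IH1.
rewrite chebS IH1 IH2.
have -> : dsum A E K (cheb_coef n.+1) = dsum A E K (cheb_coef n)
    + dsum A E K (shiftA (cheb_coef n)) - dsum A E K (shiftE (cheb_coef n))
    - dsum A E K (shiftA (chebP_coef n)).
  by rewrite (eq_dsum _ _ _ (cheb_coefS n)) !dsumD !dsumN.
rewrite -(dsumA _ _ (hA n hn)) -(dsumE _ _ (hE n hn)) -dsumA; first by ring.
by case: n hn {IH IH1 IH2} => //= n hn; apply: hA; lia.
Qed.

(** Coefficients of [cheb h - A * chebP h]: one Pascal step lowers both indices of the last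
    binomial, which at [q = 0] degenerates to the indicator of [j = 0]. *)
Definition even_coef h j q : int :=
  if (j <= h)%N then
    (-1) ^+ q * 'C(h - j, q)%:Z * (if q is q'.+1 then 'C(q' + j, q') else (j == 0%N) : nat)%:Z
  else 0.

Lemma even_coefE h j q :
  even_coef h j q = cheb_coef h j q - shiftA (chebP_coef h) j q.
Proof.
rewrite /even_coef /cheb_coef; case: j => [|j] /=.
  by rewrite subr0; case: q => [|q] /=; rewrite ?addn0 ?binn.
case: h => [|h] /=; first by rewrite subr0.
rewrite /cheb_coef ltnS; case: ifP => // jh; rewrite ?subr0 // subSS.
case: q => [|q] /=; first by rewrite !bin0; ring.
by rewrite addnS [in X in _ = X - _]addSn binS !addSn PoszD addnS; ring.
Qed.

(** * Matching with [c_s(N)] by division of [s] by [N + 1] *)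

Lemma sum_block (V : nmodType) (F : nat -> V) k K :
  \sum_(s < K * k) F s = \sum_(q < K) \sum_(r < k) F (q * k + r)%N.
Proof.
elim: K => [|K IH]; first by rewrite !big_ord0.
rewrite big_ord_recr /= -IH mulSnr big_split_ord /=; congr (_ + _).
Qed.

(** Within the range of summation [q + r < N], so [s = q N + (q + r)] yields [q_0 = q] and
    [r_0 = q + r]. *)
Lemma c_coef_even N q r (h := (N %/ 2)%N) (s := (q * N.+1 + r)%N) :
  (0 < N)%N -> (r <= h)%N ->
  [/\ (2 * s %/ N.+1 = 2 * q)%N, (2 * s %% N.+1 = 2 * r)%N &
   (if (s < (N * N.+1 %/ 2).+1)%N then c_coef N s else 0) = even_coef h r q].
Proof.
move=> N0 rh.
have e2 : (2 * s = 2 * q * N.+1 + 2 * r)%N by rewrite /s; lia.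
have lt2 : (2 * r < N.+1)%N by lia.
have ed : (2 * s %/ N.+1 = 2 * q)%N by rewrite e2 divnMDl // divn_small // addn0.
split=> //; first by rewrite e2 modnMDl modn_small.
case: ifP => hs; last first.
  (* Past the last exponent of [f_poly] one has [q > h - r], so the binomial vanishes. *)
  rewrite /even_coef rh bin_small ?mulr0 ?mul0r //.
  move: hs; rewrite /s /h in rh * => hs.
  nia.
have hqr : (q + r < N)%N by rewrite /s /h in hs rh; nia.
have es : s = (q * N + (q + r))%N by rewrite /s; lia.
have q0E : (s %/ N = q)%N by rewrite es divnMDl // divn_small // addn0.
have r0E : (s %% N = q + r)%N by rewrite es modnMDl modn_small.
rewrite /c_coef ed oddM /= q0E r0E -/h /even_coef rh.
case: eqP => [s0|s0].
  have [-> ->] : q = 0%N /\ r = 0%N by lia.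
  by rewrite bin0.
case: (leqP (q + r) h) => hqh; last by rewrite bin_small ?mulr0 ?mul0r //; lia.
case: q {hqr q0E ed e2 hs} @s es s0 r0E hqh => [|q] s es s0 r0E hqh.
  (* For [q = 0] the lower index [q_0 - 1] is negative and [binz] is 0; on the other side [r] is
     nonzero because [s] is. *)
  by rewrite bin0 /= (_ : (r == 0%N) = false) ?mulr0 ?mul0r ?mulr1 //; lia.
rewrite (_ : (q.+1 + r)%N%:Z - 1 = (q + r)%N :> int); last by lia.
rewrite (_ : q.+1%:Z - 1 = q :> int); last by lia.
rewrite (_ : h%:Z - (q.+1 + r)%N%:Z + q.+1%:Z = (h - r)%N :> int); last by lia.
by rewrite /binz mulrAC.
Qed.

(** Twice [h.+1] is [N.+1 + odd N.+1]: this makes the quotient of [2 * s] odd and leaves [odd N.+1]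
    in the remainder. *)
Lemma c_coef_odd N q j (h := (N %/ 2)%N) (s := (q * N.+1 + (j + h.+1))%N) :
  (0 < N)%N -> (j < N - h)%N ->
  [/\ (2 * s %/ N.+1 = (2 * q).+1)%N, (2 * s %% N.+1 = 2 * j + odd N.+1)%N &
   (if (s < (N * N.+1 %/ 2).+1)%N then c_coef N s else 0) = - cheb_coef (N - h.+1) j q].
Proof.
move=> N0 jh.
have oN : (2 * h.+1 = N.+1 + odd N.+1)%N by rewrite /h /=; lia.
have e2 : (2 * s = (2 * q).+1 * N.+1 + (2 * j + odd N.+1))%N by rewrite /s; nia.
have lt2 : (2 * j + odd N.+1 < N.+1)%N by lia.
have ed : (2 * s %/ N.+1 = (2 * q).+1)%N by rewrite e2 divnMDl // divn_small // addn0.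
have q1E : (s %/ N.+1 = q)%N by rewrite /s divnMDl // divn_small ?addn0 //; lia.
have r1E : (s %% N.+1 = j + h.+1)%N by rewrite /s modnMDl modn_small //; lia.
split=> //; first by rewrite e2 modnMDl modn_small.
have jl : (j <= N - h.+1)%N by lia.
rewrite /cheb_coef jl.
case: ifP => hs; last first.
  rewrite bin_small ?mulr0 ?mul0r ?oppr0 //.
  set t := (2 * j + odd N.+1)%N in e2.
  have lt3 : (N * N.+1 < (2 * q).+1 * N.+1 + t)%N by rewrite -e2; lia.
  rewrite ltnNge; apply/negP => hq.
  have : ((2 * q).+1 + t <= N)%N by rewrite /t; lia.
  rewrite -(leq_pmul2r (ltn0Sn N)) mulnDl => lt4.
  by have := leq_pmulr t (ltn0Sn N); lia.
rewrite /c_coef ed q1E r1E -/h ifF; last by rewrite /s; lia.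
rewrite ifT; last by rewrite /= oddM /=; lia.
rewrite (_ : N%:Z - (j + h.+1)%N%:Z = (N - h.+1 - j)%N :> int); last by lia.
rewrite (_ : q%:Z + (j + h.+1)%N%:Z - h%:Z - 1 = (q + j)%N :> int); last by lia.
by rewrite /binz exprS !mulN1r !mulNr.
Qed.

(** Remainders of [s] modulo [N.+1] up to [h] assemble [cheb h - A * chebP h], the larger ones the
    subtracted term of [fdet]. *)
Lemma fdet_f_poly (R : comUnitRingType) (a B : R) N : (0 < N)%N ->
  f_poly N a B = fdet N a B.
Proof.
move=> N0; set h := (N %/ 2)%N; set k := N.+1.
pose A : {poly R} := a%:P ^+ 2 * 'X; pose E : {poly R} := B%:P ^+ 2 * 'X^k.
have eA j : A ^+ j = a%:P ^+ (2 * j) * 'X^j by rewrite /A exprMn -exprM.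
have eE q : E ^+ q = B%:P ^+ (2 * q) * 'X^(q * k).
  by rewrite /E exprMn -!exprM (mulnC k).
have [c1 c2] := @cheb_dsum R A E N h ltac:(lia).
have [c3 _] := @cheb_dsum R A E N (N - h.+1) ltac:(lia).
rewrite /fdet -/h -/k -/A -/E c1 c2 c3.
have -> : dsum A E N (cheb_coef h) - A * dsum A E N (chebP_coef h) =
    dsum A E N (even_coef h).
  rewrite dsumA -?dsumN -?dsumD; last first.
    have: (h <= N)%N by lia.
    by case: (h) => [|h'] //= hN q; rewrite /cheb_coef leqNgt hN.
  by apply: eq_dsum => j q; rewrite even_coefE.
(* Padding with zeros up to [k * k] lets [(q, r)] range over a full square. *)
pose G s := (if (s < (N * k %/ 2).+1)%N then c_coef N s else 0)%:~R%:P
  * a%:P ^+ (2 * s %% k) * B%:P ^+ (2 * s %/ k) * 'X^s : {poly R}.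
have -> : f_poly N a B = \sum_(s < k * k) G s.
  rewrite /f_poly (big_ord_widen (k * k) (fun s => ((c_coef N s)%:~R * a ^+ (2 * s %% k)
     * B ^+ (2 * s %/ k)) *: 'X^s)); last by rewrite /k; nia.
  rewrite big_mkcond; apply: eq_bigr => s _; rewrite /G; case: ifP => _; last by rewrite !mul0r.
  by rewrite -mul_polyC !rmorphM /= !rmorphXn.
rewrite sum_block /dsum [X in _ = X - _]exchange_big /=.
rewrite [X in _ - _ * X]exchange_big mulr_sumr -sumrB; apply: eq_bigr => q _.
rewrite -(big_mkord xpredT (fun r => G (q * k + r)%N)) (@big_cat_nat _ _ _ h.+1) //=; last by lia.
rewrite -(big_mkord xpredT (fun j => (even_coef h j q)%:~R * A ^+ j * E ^+ q)).
rewrite (@big_cat_nat _ _ _ h.+1 0 N.+1) //=; last by lia.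
rewrite [X in _ = _ + X - _]big_nat_cond [X in _ = _ + X - _]big1 ?addr0; last first.
  by move=> j hj; rewrite /even_coef ifF ?mul0r //; lia.
congr (_ + _).
  apply: eq_big_nat => r hr.
  have [e1 e2 e3] := @c_coef_even N q r N0 ltac:(lia).
  rewrite /G e1 e2 e3 rmorph_int eA eE exprD -/h.
  by move: (a%:P ^+ _) (B%:P ^+ _) ('X^(q * k)) ('X^r) => *; ring.
rewrite -(big_mkord xpredT (fun j => (cheb_coef (N - h.+1) j q)%:~R * A ^+ j * E ^+ q)).
rewrite (@big_cat_nat _ _ _ (N - h) 0 N.+1) //=; last by lia.
rewrite [X in _ = - (_ * (_ + X))]big_nat_cond [X in _ = - (_ * (_ + X))]big1 ?addr0; last first.
  by move=> j hj; rewrite /cheb_coef ifF ?mul0r //; lia.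
rewrite -[h.+1 in LHS]add0n big_addn (_ : (k - h.+1 = N - h)%N); last by lia.
rewrite mulr_sumr -sumrN; apply: eq_big_nat => j hj.
have [e1 e2 e3] := @c_coef_odd N q j N0 ltac:(lia).
rewrite /G e1 e2 e3 rmorph_int eA eE exprS !exprD -/h -/k rmorphN /=.
by rewrite !expr0; move: (a%:P ^+ (~~ _)) (a%:P ^+ j) (B%:P ^+ q) ('X^j) ('X^(q * k)) ('X^(h.+1)) => *; ring.
Qed.

Lemma f_poly_coef0 (R : comUnitRingType) (N : nat) (a b : R) : (f_poly N a b)`_0 = 1.
Proof.
rewrite /f_poly coef_sum big_ord_recl big1 ?addr0 => [|s _]; last first.
  by rewrite coefZ coefXn mulr0.
by rewrite coefZ coefXn /= muln0 mod0n div0n !expr0 !mulr1.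
Qed.

Theorem theorem1p3 (R : comUnitRingType) (a b : R) (k : nat) (hk : (1 < k)%N) :
  fps_eq_quot (F_ser k a b)
    ((1 - b ^+ (2 * k) *: 'X^k) ^+ (k - 1) * f_poly (k - 1) a (b ^+ k))
    (sqrt_prod (p_poly k a b)
       * (1 - b ^+ (2 * k) *: 'X^k) ^+ (k - 1) * f_poly (k - 1) a (- b ^+ k)
     - ((k - 1)%:R * a ^+ k * b ^+ k) *: 'X^k * f_poly (k - 1) a (b ^+ k)).
Proof.
set P := _ ^+ _ * f_poly _ _ (b ^+ k); set Q := (X in fps_eq_quot _ _ X).
have FZ n : F_ser k a b n = profile_sum a b (2 * k) k (fun=> n).
  rewrite /F_ser tiling_sum_region //.
  by rewrite (@profile_sumE _ _ _ _ _ hk n).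
have H n : \sum_(i < n.+1) F_ser k a b i * Q`_(n - i) = P`_n.
  (* Truncation at [n.+1] keeps the coefficient of ['X^n] exact. *)
  have := @F_ser_fdet R a b k n.+1 hk n (ltnSn n).
  rewrite -!fdet_f_poly ?subn_gt0 // -/P -/Q coefB coefM => /eqP.
  rewrite subr_eq0 => /eqP <-; apply: eq_bigr => i _.
  by rewrite coef_poly ltn_ord FZ.
split=> //.
(* Since [F] starts with 1, the case [n = 0] identifies the constant terms of [Q] and [P], and that
   of [P] is 1. *)
have := H 0; rewrite big_ord1 subn0 FZ {1}/profile_sum region_sum0 // mul1r => ->.
rewrite /P coefM big_ord1 f_poly_coef0 mulr1 -horner_coef0 !hornerE expr0n.
rewrite (gtn_eqF (ltnW hk)) mulr0 subr0 expr1n; exact: unitr1.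
Qed.
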